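(* Let $N=(P,T_1,T_2,W,I)$ be a Petri net game and $\varphi$ a reachability formula. For every marking $M$, the algorithm $\mathit{Stub}(N,M,\varphi)$ described below terminates (for all nondeterministic choices). Moreover, if for every marking $M$ the nondeterministic choices are fixed and $St(M)$ denotes the output of $\mathit{Stub}(N,M,\varphi)$, then $St$ is a stable reduction of the GLTS $G(N)$ with goal set $\mathit{Goal}_\varphi=\{M\mid M\models\varphi\}$, i.e. it satisfies Conditions I, W, R, G1, G2, S, V and D at every marking, with Condition R taken with respect to the interesting sets $\mathcal{I}_M(\varphi)$ (computed with the same choices as in the algorithm).
   Context: A Petri net game is $N=(P,T_1,T_2,W,I)$ with finite disjoint sets of places $P$ and transitions $T=T_1\uplus T_2$, $W:(P\times T)\cup(T\times P)\to\mathbb{N}_0$, $I:P\times T\to\mathbb{N}\cup\{\infty\}$. Markings are $M:P\to\mathbb{N}_0$; $t$ is enabled in $M$ iff $M(p)\ge W(p,t)$ and $M(p)<I(p,t)$ for all $p$, and then $M\xrightarrow{t}M'$ with $M'(p)=M(p)-W(p,t)+W(t,p)$; extend to sequences. $G(N)$ is the GLTS with states the markings, player 1 actions $T_1$, player 2 actions $T_2$, and goal set $\mathit{Goal}_\varphi$. $en_i(M)$ = enabled transitions of $T_i$, $en(M)=en_1(M)\cup en_2(M)$. Notation: $^\bullet x=\{y\mid W(y,x)>0\}$, $x^\bullet=\{y\mid W(x,y)>0\}$, ${}^\circ t=\{p\mid I(p,t)\ne\infty\}$, $p^{\circ}=\{t\mid I(p,t)\ne\infty\}$, ${}^+p=\{t\in{}^\bullet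 p\mid W(t,p)>W(p,t)\}$, $p^-=\{t\in p^\bullet\mid W(t,p)<W(p,t)\}$, $t^{\ominus}=\{p\in{}^\bullet t\mid W(p,t)>W(t,p)\}$, $t^{\oplus}=\{p\in t^\bullet\mid W(p,t)<W(t,p)\}$, extended to sets by union. $\mathit{safe}(M)$: if $en_2(M)=\emptyset$, $t\in en_1(M)$ is in $\mathit{safe}(M)$ iff for every $w\in(T_1\setminus\{t\})^*$ with $M\xrightarrow{w}M_1$, $en_2(M_1)=\emptyset$ and $M\xrightarrow{tw}M_2$, we have $en_2(M_2)=\emptyset$; if $en_2(M)\ne\emptyset$ take $\mathit{safe}(M)=\emptyset$. Expressions, formulas and $\mathcal{I}_M(\varphi)$: expressions $e::=c\mid p\mid e_1+e_2\mid e_1-e_2\mid e_1*e_2$; $\mathit{incr}(c)=\mathit{decr}(c)=\emptyset$, $\mathit{incr}(p)={}^+p$, $\mathit{decr}(p)=p^-$, sums take unions, $\mathit{incr}(e_1-e_2)=\mathit{incr}(e_1)\cup\mathit{decr}(e_2)$, $\mathit{decr}(e_1-e_2)=\mathit{decr}(e_1)\cup\mathit{incr}(e_2)$, $\mathit{incr}(e_1*e_2)=\mathit{decr}(e_1*e_2)$ = union of all four. Formulas $\varphi::=\mathit{true}\mid\mathit{false}\mid t\mid e_1\bowtie e_2\mid\mathit{deadlock}\mid\varphi_1\wedge\varphi_2\mid\varphi_1\vee\varphi_2\mid\neg\varphi$ with the natural semantics ($M\models t$ iff $t\in en(M)$, $M\models\mathit{deadlock}$ iff $en(M)=\emptyset$).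 $\mathcal{I}_M(\varphi)=\emptyset$ if $M\models\varphi$; otherwise: $\mathit{deadlock}$: $\{t\}\cup({}^\bullet t)^-\cup{}^+({}^\circ t)$ for a selected $t\in en(M)$; $t$: ${}^+p$ for a selected $p\in{}^\bullet t$ with $M(p)<W(p,t)$, or $p^-$ for a selected $p\in{}^\circ t$ with $M(p)\ge I(p,t)$; $<,\le$: $\mathit{decr}(e_1)\cup\mathit{incr}(e_2)$; $>,\ge$: $\mathit{incr}(e_1)\cup\mathit{decr}(e_2)$; $=$: $\mathit{decr}(e_1)\cup\mathit{incr}(e_2)$ if $\mathit{eval}_M(e_1)>\mathit{eval}_M(e_2)$, else $\mathit{incr}(e_1)\cup\mathit{decr}(e_2)$; $\ne$: union of all four; $\vee$: union; $\varphi_1\wedge\varphi_2$: first applicable of $\mathcal{I}_M(\varphi_1)$ if $M\models\varphi_2$; $\mathcal{I}_M(\varphi_2)$ if $M\models\varphi_1$; $\mathcal{I}_M(\varphi_1)$ if $M\not\models\varphi_1$ and $\mathcal{I}_M(\varphi_1)\subseteq\mathit{safe}(M)$; $\mathcal{I}_M(\varphi_2)$ if $M\not\models\varphi_2$ and $\mathcal{I}_M(\varphi_2)\subseteq\mathit{safe}(M)$; else $\mathcal{I}_M(\varphi_i)$ for a selected $i$. Negations: $\neg\mathit{deadlock}$: $\emptyset$; $\neg t$: $({}^\bullet t)^-\cup{}^+({}^\circ t)$; negated comparisons use the complementary comparison; De Morgan for $\neg(\varphi_1\wedge\varphi_2)$, $\neg(\varphi_1\vee\varphi_2)$; $\mathcal{I}_M(\mathit{false})=\mathcal{I}_M(\neg\mathit{true})=\emptyset$,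 $\mathcal{I}_M(\neg\neg\varphi)=\mathcal{I}_M(\varphi)$. $\mathit{reach}(N,M,\varphi)$: put $\varphi$ in negation normal form; with $\min\emptyset=\infty$, $\sum\emptyset=0$: $ub(x)=\infty$ for $x\in P\cup T_2$; $ub(p)=M(p)$ if $W(p,t)\ge W(t,p)$ for all $t\in{}^\bullet p\cap T_2$; repeat until stable: $ub(t):=\min_{p\in t^{\ominus}}\lfloor ub(p)/(W(p,t)-W(t,p))\rfloor$ for $t\in T_2$, then $ub(p):=M(p)+\sum_{t\in{}^\bullet p\cap T_2,W(t,p)>W(p,t)}ub(t)(W(t,p)-W(p,t))$; then $lb(p):=M(p)-\sum_{t\in T_2,W(p,t)>W(t,p)}ub(t)(W(p,t)-W(t,p))$; return whether $lb,ub\models\varphi$ where: $t$ holds iff $ub(p)\ge W(p,t)$ on ${}^\bullet t$ and $lb(p)<I(p,t)$ on ${}^\circ t$; $\neg t$ iff $lb(p)<W(p,t)$ for some $p\in{}^\bullet t$ or $ub(p)\ge I(p,t)$ for some $p\in{}^\circ t$; $e_1<e_2$ iff $lb(e_1)<ub(e_2)$; $\le$ analogously; $e_1=e_2$ iff $\max\{lb(e_1),lb(e_2)\}\le\min\{ub(e_1),ub(e_2)\}$; $e_1\ne e_2$ iff not all of $lb(e_1),lb(e_2),ub(e_1),ub(e_2)$ equal; $e_1\ge e_2$ iff $ub(e_1)\ge lb(e_2)$; $>$ analogously; $\mathit{deadlock}$ iff no $t\in T$ satisfies the $t$-condition; $\neg\mathit{deadlock}$ iff some does; $\mathit{true}$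 holds, $\mathit{false}$ does not; $\wedge,\vee$ as usual; expression bounds by interval arithmetic ($lb(e_1-e_2)=lb(e_1)-ub(e_2)$ etc., products via min/max of the four bound products). Algorithm $\mathit{Stub}(N,M,\varphi)$: if $en(M)=\emptyset$ return $T$. If $en_1(M)\ne\emptyset$ and $en_2(M)\ne\emptyset$ return $T$. If $en_1(M)=\emptyset$: if $\mathit{reach}(N,M,\varphi)$ return $T$; otherwise pick any $t\in en_2(M)$ and set $Y:=T_1\cup\{t\}\cup({}^\bullet t)^-\cup{}^+({}^\circ t)$. Otherwise set $Y:=T_2$. Then $Y:=Y\cup\mathcal{I}_M(\varphi)$ and $X:=\mathit{Saturate}(Y)$. If $X\cap en_1(M)\not\subseteq\mathit{safe}(M)$ return $T$; else return $X$. $\mathit{Saturate}(Y)$: $X:=\emptyset$; while $Y\ne\emptyset$: pick any $t\in Y$; if $t\notin en(M)$: if some $p\in{}^\bullet t$ has $M(p)<W(p,t)$, pick such $p$ and set $Y:=Y\cup({}^+p\setminus X)$; otherwise pick $p\in{}^\circ t$ with $M(p)\ge I(p,t)$ and set $Y:=Y\cup(p^-\setminus X)$; if $t\in en(M)$: $Y:=Y\cup\big((t^{\ominus})^\bullet\cup(t^{\oplus})^{\circ}\big)\setminus X$; then $X:=X\cup\{t\}$, $Y:=Y\setminus\{t\}$. Return $X$. Stability conditions at a marking $s$ for a reduction $St$ ($\overline{St(s)}=T\setminus St(s)$): (I) if $en_1(s),en_2(s)\ne\emptyset$ then $en(s)\subseteq St(s)$; (W) for $w\in\overline{St(s)}^*$,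 $a\in St(s)$: $s\xrightarrow{wa}s'$ implies $s\xrightarrow{aw}s'$; (R) $\mathcal{I}_s(\varphi)\subseteq St(s)$; (G1) if $en_2(s)=\emptyset$ and $s\xrightarrow{w}s'$, $w\in\overline{St(s)}^*$, then $en_2(s')=\emptyset$; (G2) same with $en_1$; (S) $en_1(s)\cap St(s)\subseteq\mathit{safe}(s)$ or $en_1(s)\subseteq St(s)$; (V) if $s\xrightarrow{w}s'\in\mathit{Goal}_\varphi$ for some $w\in T_2^*$ then $en_2(s)\subseteq St(s)$; (D) if $en_2(s)\ne\emptyset$ there is $a\in en_2(s)\cap St(s)$ with $a\in en_2(s')$ whenever $s\xrightarrow{w}s'$, $w\in\overline{St(s)}^*$.
   Formalization: In reach, the rule for deadlock is corrected: lb,ub satisfy deadlock iff every transition t satisfies the condition for ''not t'', instead of ''no t satisfies the t-condition''; with the literal rule Condition V can fail (e.g. two independent player 2 transitions, phi = deadlock). *)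

(* Defs.v *)
From HB Require Import structures.
From Stdlib Require Export Relation_Operators.
From mathcomp Require Export all_boot all_order all_algebra.
From mathcomp Require Export constructive_ereal.

Set Implicit Arguments.
Unset Strict Implicit.
Unset Printing Implicit Defensive.

Import Order.TTheory GRing.Theory Num.Theory.

(** * Game labelled transition systems and stable reductions *)

(* The actions of player 2 are the complement of those of player 1.  The goal
   is kept out of [arena] because [safe] does not depend on it. *)
Record arena := Arena {
  state : Type;
  action : finType;
  player1 : {set action};
  trans : state -> action -> state -> Prop }.

Record glts := Glts {
  glts_arena :> arena;
  goal : state glts_arena -> Prop }.

Section Arena.
Variable G : arena.
Implicit Types (s : state G) (a : action G) (w : seq (action G)).

Definition player2 : {set action G} := ~: player1 G.

Fixpoint run s w s' : Prop :=
  if w is a :: w' then exists2 s1, trans s a s1 & run s1 w' s' else s = s'.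

Definition can s a := exists s', trans s a s'.
Definition can1 s a := a \in player1 G /\ can s a.
Definition can2 s a := a \in player2 /\ can s a.

Definition safe s a :=
  [/\ ~ (exists b, can2 s b), can1 s a &
      forall w s1 s2,
        {subset w <= player1 G :\ a} ->
        run s w s1 -> ~ (exists b, can2 s1 b) ->
        run s (a :: w) s2 -> ~ (exists b, can2 s2 b)].

End Arena.

Section Stability.
Variable G : glts.
Variables (Int St : state G -> {set action G}).
Implicit Types (s : state G) (a : action G) (w : seq (action G)).

Definition condI s :=
  (exists a, can1 s a) -> (exists a, can2 s a) ->
  forall a, can s a -> a \in St s.

Definition condW s :=
  forall w a s', {subset w <= ~: St s} -> a \in St s ->
  run s (rcons w a) s' -> run s (a :: w) s'.

Definition condR s := Int s \subset St s.

Definition condG1 s :=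
  ~ (exists a, can2 s a) ->
  forall w s', {subset w <= ~: St s} -> run s w s' -> ~ (exists a, can2 s' a).

Definition condG2 s :=
  ~ (exists a, can1 s a) ->
  forall w s', {subset w <= ~: St s} -> run s w s' -> ~ (exists a, can1 s' a).

Definition condS s :=
  (forall a, can1 s a -> a \in St s -> safe s a) \/
  (forall a, can1 s a -> a \in St s).

Definition condV s :=
  (exists w s', [/\ {subset w <= player2 G}, run s w s' & goal s']) ->
  forall a, can2 s a -> a \in St s.

Definition condD s :=
  (exists a, can2 s a) ->
  exists a, [/\ can2 s a, a \in St s &
    forall w s', {subset w <= ~: St s} -> run s w s' -> can2 s' a].

Definition stable_reduction :=
  forall s, condI s /\ condW s /\ condR s /\ condG1 s /\ condG2 s /\
            condS s /\ condV s /\ condD s.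

End Stability.

(** * Petri net games *)

(* [None] is the inhibitor weight infinity; finite inhibitor weights are
   positive. *)
Record petri_game := PetriGame {
  place : finType;
  transition : finType;
  T1 : {set transition};
  Win : place -> transition -> nat;
  Wout : transition -> place -> nat;
  inhib : place -> transition -> option nat;
  inhib_gt0 : forall p t n, inhib p t = Some n -> 0 < n }.

Section PetriGame.
Variable N : petri_game.
Local Notation P := (place N).
Local Notation T := (transition N).
Implicit Types (p : P) (t : T) (A X Y : {set T}).

Definition T2 : {set T} := ~: T1 N.

Definition marking := {ffun P -> nat}.
Implicit Types M : marking.

Definition below_inhib (n : nat) (i : option nat) : bool :=
  if i is Some k then n < k else true.

Definition enabled M t : bool :=
  [forall p, (Win p t <= M p) && below_inhib (M p) (inhib p t)].

Definition fire M t : marking := [ffun p => M p - Win p t + Wout t p].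

Definition net_arena : arena :=
  @Arena marking T (T1 N) (fun M t M' => enabled M t /\ M' = fire M t).

Definition en M : {set T} := [set t | enabled M t].
Definition en1 M : {set T} := en M :&: T1 N.
Definition en2 M : {set T} := en M :&: T2.

Definition pre t : {set P} := [set p | 0 < Win p t].
Definition inh t : {set P} := [set p | inhib p t != None].
Definition ominus t : {set P} := [set p in pre t | Wout t p < Win p t].
Definition oplus t : {set P} := [set p | (0 < Wout t p) && (Win p t < Wout t p)].
Definition ppost p : {set T} := [set t | 0 < Win p t].
Definition pinh p : {set T} := [set t | inhib p t != None].
Definition pplus p : {set T} := [set t | (0 < Wout t p) && (Win p t < Wout t p)].
Definition pminus p : {set T} := [set t in ppost p | Wout t p < Win p t].

(* The transitions that can disable [t]. *)
Definition disabling t : {set T} :=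
  (\bigcup_(p in pre t) pminus p) :|: (\bigcup_(p in inh t) pplus p).

(** * Formulas *)

Inductive expr :=
| EConst of int
| EPlace of P
| EAdd of expr & expr
| ESub of expr & expr
| EMul of expr & expr.

Inductive cmp := Lt | Le | Eq | Ne | Gt | Ge.

Definition cmpC (o : cmp) : cmp :=
  match o with Lt => Ge | Le => Gt | Eq => Ne | Ne => Eq | Gt => Le | Ge => Lt end.

Inductive formula :=
| FTrue
| FFalse
| FTrans of T
| FCmp of cmp & expr & expr
| FDeadlock
| FAnd of formula & formula
| FOr of formula & formula
| FNot of formula.

Fixpoint eval M (e : expr) : int :=
  match e with
  | EConst c => c
  | EPlace p => (M p)%:Z
  | EAdd e1 e2 => (eval M e1 + eval M e2)%R
  | ESub e1 e2 => (eval M e1 - eval M e2)%R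
  | EMul e1 e2 => (eval M e1 * eval M e2)%R
  end.

Definition eval_cmp (o : cmp) (x y : int) : bool :=
  match o with
  | Lt => (x < y)%R
  | Le => (x <= y)%R
  | Eq => x == y
  | Ne => x != y
  | Gt => (x > y)%R
  | Ge => (x >= y)%R
  end.

Fixpoint sat M (f : formula) : bool :=
  match f with
  | FTrue => true
  | FFalse => false
  | FTrans t => t \in en M
  | FCmp o e1 e2 => eval_cmp o (eval M e1) (eval M e2)
  | FDeadlock => en M == set0
  | FAnd f1 f2 => sat M f1 && sat M f2
  | FOr f1 f2 => sat M f1 || sat M f2
  | FNot f1 => ~~ sat M f1
  end.

Definition net_glts (f : formula) : glts :=
  @Glts net_arena (fun M : marking => sat M f).

(** * Interesting sets *)

Fixpoint incr (e : expr) : {set T} :=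
  match e with
  | EConst _ => set0
  | EPlace p => pplus p
  | EAdd e1 e2 => incr e1 :|: incr e2
  | ESub e1 e2 => incr e1 :|: decr e2
  | EMul e1 e2 => incr e1 :|: decr e1 :|: incr e2 :|: decr e2
  end
with decr (e : expr) : {set T} :=
  match e with
  | EConst _ => set0
  | EPlace p => pminus p
  | EAdd e1 e2 => decr e1 :|: decr e2
  | ESub e1 e2 => decr e1 :|: incr e2
  | EMul e1 e2 => incr e1 :|: decr e1 :|: incr e2 :|: decr e2
  end.

Definition interesting_cmp M (o : cmp) (e1 e2 : expr) : {set T} :=
  match o with
  | Lt | Le => decr e1 :|: incr e2
  | Gt | Ge => incr e1 :|: decr e2
  | Eq => if (eval M e1 > eval M e2)%R then decr e1 :|: incr e2
          else incr e1 :|: decr e2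
  | Ne => incr e1 :|: decr e1 :|: incr e2 :|: decr e2
  end.

Definition all_safe M (A : {set T}) : Prop :=
  forall t, t \in A -> @safe net_arena M t.

(* [select_and M f1 f2 A1 A2 A]: if [A1] and [A2] are the interesting sets of
   [f1] and [f2], then [A] is a possible interesting set of an unsatisfied
   conjunction of [f1] and [f2]. *)
Inductive select_and M (f1 f2 : formula) (A1 A2 : {set T}) : {set T} -> Prop :=
| and_sat2 of sat M f2 : select_and M f1 f2 A1 A2 A1
| and_sat1 of ~~ sat M f2 & sat M f1 : select_and M f1 f2 A1 A2 A2
| and_safe1 of ~~ sat M f2 & ~~ sat M f1 & all_safe M A1 :
    select_and M f1 f2 A1 A2 A1
| and_safe2 of ~~ sat M f2 & ~~ sat M f1 & ~ all_safe M A1 & all_safe M A2 :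
    select_and M f1 f2 A1 A2 A2
| and_any1 of ~~ sat M f2 & ~~ sat M f1 & ~ all_safe M A1 & ~ all_safe M A2 :
    select_and M f1 f2 A1 A2 A1
| and_any2 of ~~ sat M f2 & ~~ sat M f1 & ~ all_safe M A1 & ~ all_safe M A2 :
    select_and M f1 f2 A1 A2 A2.

(* [interesting M f A]: some sequence of selections gives [A] as the value of
   the interesting set of [f] at [M]. *)
Inductive interesting M : formula -> {set T} -> Prop :=
| int_sat f of sat M f :
    interesting M f set0
| int_false :
    interesting M FFalse set0
| int_ntrue :
    interesting M (FNot FTrue) set0
| int_deadlock t of t \in en M :
    interesting M FDeadlock (t |: disabling t)
| int_ndeadlock of ~~ sat M (FNot FDeadlock) :
    interesting M (FNot FDeadlock) set0
| int_trans_pre t p of p \in pre t & M p < Win p t :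
    interesting M (FTrans t) (pplus p)
| int_trans_inh t p of p \in inh t & ~~ below_inhib (M p) (inhib p t) :
    interesting M (FTrans t) (pminus p)
| int_ntrans t of ~~ sat M (FNot (FTrans t)) :
    interesting M (FNot (FTrans t)) (disabling t)
| int_cmp o e1 e2 of ~~ sat M (FCmp o e1 e2) :
    interesting M (FCmp o e1 e2) (interesting_cmp M o e1 e2)
| int_ncmp o e1 e2 of ~~ sat M (FNot (FCmp o e1 e2)) :
    interesting M (FNot (FCmp o e1 e2)) (interesting_cmp M (cmpC o) e1 e2)
| int_or f1 f2 A1 A2 of ~~ sat M (FOr f1 f2)
    & interesting M f1 A1 & interesting M f2 A2 :
    interesting M (FOr f1 f2) (A1 :|: A2)
| int_nand f1 f2 A1 A2 of ~~ sat M (FNot (FAnd f1 f2))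
    & interesting M (FNot f1) A1 & interesting M (FNot f2) A2 :
    interesting M (FNot (FAnd f1 f2)) (A1 :|: A2)
| int_and f1 f2 A1 A2 A of ~~ sat M (FAnd f1 f2)
    & interesting M f1 A1 & interesting M f2 A2 & select_and M f1 f2 A1 A2 A :
    interesting M (FAnd f1 f2) A
| int_nor f1 f2 A1 A2 A of ~~ sat M (FNot (FOr f1 f2))
    & interesting M (FNot f1) A1 & interesting M (FNot f2) A2
    & select_and M (FNot f1) (FNot f2) A1 A2 A :
    interesting M (FNot (FOr f1 f2)) A
| int_nnot f A of interesting M f A :
    interesting M (FNot (FNot f)) A.

(** * The check reach *)

(* Negation normal form of [f], or of its negation if [neg]. *)
Fixpoint nnf (neg : bool) (f : formula) : formula :=
  match f with
  | FTrue => if neg then FFalse else FTrue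
  | FFalse => if neg then FTrue else FFalse
  | FTrans t => if neg then FNot (FTrans t) else FTrans t
  | FCmp o e1 e2 => FCmp (if neg then cmpC o else o) e1 e2
  | FDeadlock => if neg then FNot FDeadlock else FDeadlock
  | FAnd f1 f2 => if neg then FOr (nnf true f1) (nnf true f2)
                  else FAnd (nnf false f1) (nnf false f2)
  | FOr f1 f2 => if neg then FAnd (nnf true f1) (nnf true f2)
                 else FOr (nnf false f1) (nnf false f2)
  | FNot f1 => nnf (~~ neg) f1
  end.

Definition natE (n : nat) : \bar int := (n%:Z)%:E.

Definition inhibE p t : \bar int := if inhib p t is Some k then natE k else +oo%E.

(* Floor division by a positive number. *)
Definition floor_divE (x : \bar int) (k : nat) : \bar int :=
  if x is (r%:E)%E then ((r %/ k%:Z)%Z)%:E else x.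

(* The bounds [ub] on places and on the transitions of player 2; the entries of
   the transitions of player 1 are dummies. *)
Definition bounds := ({ffun P -> \bar int} * {ffun T -> \bar int})%type.

Definition ub_init M : bounds :=
  ([ffun p : P => if [forall t in T2, (0 < Wout t p) ==> (Wout t p <= Win p t)]
                  then natE (M p) else +oo%E],
   [ffun t : T => +oo%E]).

Definition ub_trans (ubP : {ffun P -> \bar int}) : {ffun T -> \bar int} :=
  [ffun t : T => if t \in T2 then
                   \big[mine/+oo%E]_(p in ominus t)
                     floor_divE (ubP p) (Win p t - Wout t p)
                 else +oo%E].

Definition ub_place M (ubT : {ffun T -> \bar int}) : {ffun P -> \bar int} :=
  [ffun p : P => (natE (M p) +
     \sum_(t in T2 :&: pplus p) ubT t * natE (Wout t p - Win p t)%N)%E].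

Definition ub_step M (u : bounds) : bounds :=
  let ubT := ub_trans u.1 in (ub_place M ubT, ubT).

Definition lb_place M (u : bounds) : {ffun P -> \bar int} :=
  [ffun p : P => (natE (M p) -
     \sum_(t in T2 | (Wout t p < Win p t)%N) u.2 t * natE (Win p t - Wout t p)%N)%E].

Section BoundSat.
Variables lb ub : {ffun P -> \bar int}.

(* In [\bar int], 0 * +oo = 0. *)
Fixpoint lbE (e : expr) : \bar int :=
  match e with
  | EConst c => c%:E
  | EPlace p => lb p
  | EAdd e1 e2 => (lbE e1 + lbE e2)%E
  | ESub e1 e2 => (lbE e1 - ubE e2)%E
  | EMul e1 e2 => mine (mine (lbE e1 * lbE e2)%E (lbE e1 * ubE e2)%E)
                       (mine (ubE e1 * lbE e2)%E (ubE e1 * ubE e2)%E)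
  end
with ubE (e : expr) : \bar int :=
  match e with
  | EConst c => c%:E
  | EPlace p => ub p
  | EAdd e1 e2 => (ubE e1 + ubE e2)%E
  | ESub e1 e2 => (ubE e1 - lbE e2)%E
  | EMul e1 e2 => maxe (maxe (lbE e1 * lbE e2)%E (lbE e1 * ubE e2)%E)
                       (maxe (ubE e1 * lbE e2)%E (ubE e1 * ubE e2)%E)
  end.

Definition bsat_trans t : bool :=
  [forall p in pre t, (natE (Win p t) <= ub p)%E] &&
  [forall p in inh t, (lb p < inhibE p t)%E].

Definition bsat_ntrans t : bool :=
  [exists p in pre t, (lb p < natE (Win p t))%E] ||
  [exists p in inh t, (inhibE p t <= ub p)%E].

Definition bsat_cmp (o : cmp) (e1 e2 : expr) : bool :=
  match o with
  | Lt => (lbE e1 < ubE e2)%E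
  | Le => (lbE e1 <= ubE e2)%E
  | Eq => (maxe (lbE e1) (lbE e2) <= mine (ubE e1) (ubE e2))%E
  | Ne => ~~ [&& lbE e1 == lbE e2, lbE e2 == ubE e1 & ubE e1 == ubE e2]
  | Gt => (ubE e1 > lbE e2)%E
  | Ge => (ubE e1 >= lbE e2)%E
  end.

(* [lb, ub |= f] for [f] in negation normal form.  Deadlock is the conjunction
   of the negative literals of all transitions, and as such it is evaluated by
   the rule for negative literals.  The complement of [bsat_trans] would not
   do: a transition enabled at the initial marking satisfies [bsat_trans], so
   the check would never see a deadlock that player 2 can reach, and the
   resulting reduction would violate [condV]. *)
Fixpoint bsat (f : formula) : bool :=
  match f with
  | FTrue => true
  | FFalse => false
  | FTrans t => bsat_trans t
  | FNot (FTrans t) => bsat_ntrans t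
  | FCmp o e1 e2 => bsat_cmp o e1 e2
  | FDeadlock => [forall t, bsat_ntrans t]
  | FNot FDeadlock => [exists t, bsat_trans t]
  | FAnd f1 f2 => bsat f1 && bsat f2
  | FOr f1 f2 => bsat f1 || bsat f2
  | FNot _ => false
  end.

End BoundSat.

Definition reach_check M (f : formula) (u : bounds) : bool :=
  bsat (lb_place M u) u.1 (nnf false f).

(** * The algorithm Stub, as a nondeterministic transition system *)

(* Every configuration but the initial one records the interesting set [A]
   selected for this execution.  The selection comes first, so that it is also
   available to the condition R when the algorithm returns without using it. *)
Inductive config :=
| Init
| Started (A : {set T})
| Reaching (A : {set T}) (u : bounds)
| Saturating (A X Y : {set T})
| Returned (A X : {set T}).

Inductive stub_step M (f : formula) : config -> config -> Prop :=
| stub_select A of interesting M f A :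
    stub_step M f Init (Started A)
| stub_dead A of en M = set0 :
    stub_step M f (Started A) (Returned A setT)
| stub_mixed A of en1 M != set0 & en2 M != set0 :
    stub_step M f (Started A) (Returned A setT)
| stub_player2 A of en1 M = set0 & en2 M != set0 :
    stub_step M f (Started A) (Reaching A (ub_init M))
| stub_player1 A of en1 M != set0 & en2 M = set0 :
    stub_step M f (Started A) (Saturating A set0 (T2 :|: A))
| reach_iter A u of ub_step M u != u :
    stub_step M f (Reaching A u) (Reaching A (ub_step M u))
| reach_true A u of ub_step M u = u & reach_check M f u :
    stub_step M f (Reaching A u) (Returned A setT)
| reach_false A u t of ub_step M u = u & ~~ reach_check M f u & t \in en2 M :
    stub_step M f (Reaching A u)
      (Saturating A set0 ((T1 N :|: (t |: disabling t)) :|: A))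
| saturate_pre A X Y t p of t \in Y & t \notin en M
    & p \in pre t & M p < Win p t :
    stub_step M f (Saturating A X Y)
      (Saturating A (t |: X) ((Y :|: (pplus p :\: X)) :\ t))
| saturate_inh A X Y t p of t \in Y & t \notin en M
    & (forall q, q \in pre t -> Win q t <= M q)
    & p \in inh t & ~~ below_inhib (M p) (inhib p t) :
    stub_step M f (Saturating A X Y)
      (Saturating A (t |: X) ((Y :|: (pminus p :\: X)) :\ t))
| saturate_en A X Y t of t \in Y & t \in en M :
    stub_step M f (Saturating A X Y)
      (Saturating A (t |: X)
        ((Y :|: (((\bigcup_(p in ominus t) ppost p) :|:
                  (\bigcup_(p in oplus t) pinh p)) :\: X)) :\ t))
| stub_unsafe A X of ~ all_safe M (X :&: en1 M) :
    stub_step M f (Saturating A X set0) (Returned A setT)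
| stub_safe A X of all_safe M (X :&: en1 M) :
    stub_step M f (Saturating A X set0) (Returned A X).

Definition stub_steps M (f : formula) : config -> config -> Prop :=
  clos_refl_trans config (stub_step M f).

(* All executions are finite, and an execution can stop only by returning. *)
Definition stub_terminates M (f : formula) : Prop :=
  Acc (fun c' c => stub_step M f c c') Init /\
  forall c, stub_steps M f Init c ->
    (exists A X, c = Returned A X) \/ (exists c', stub_step M f c c').

(* [Stub] can return [X] with [A] as the selected interesting set. *)
Definition stub_returns M (f : formula) (A X : {set T}) : Prop :=
  stub_steps M f Init (Returned A X).

End PetriGame.

(* Main.v *)
Require Import Defs.
From Stdlib Require Import Classical.
From mathcomp Require Import zify.

(* A set saturated at [M] commutes with every run outside it: a disabled member
   stays disabled because it contains all transitions that could repair one of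
   the places blocking that member, and an enabled member does not influence
   outside transitions. This gives W, and G1, G2 since all transitions of the
   player without moves are in the seed of the saturation; D holds because the
   seed contains the transitions that can disable the selected one.

   For V, the bounds computed by reach hold for all runs of player 2, and
   interval arithmetic is sound, so a failed check excludes the goal. The bounds
   form a decreasing sequence of tuples over the naturals with infinity, which is
   well-founded; saturation terminates because no transition reenters [Y]. *)

Set Implicit Arguments.
Unset Strict Implicit.
Unset Printing Implicit Defensive.

Import Order.TTheory GRing.Theory Num.Theory.

(** * Extended integers *)

Lemma natE_ge0 n : (0 <= natE n)%E.
Proof. by rewrite lee_fin. Qed.

Lemma natED m n : natE (m + n) = (natE m + natE n)%E.
Proof. by rewrite /natE PoszD EFinD. Qed.

Lemma natEM m n : natE (m * n) = (natE m * natE n)%E.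
Proof. by rewrite /natE PoszM EFinM. Qed.

Lemma natE_sum (I : Type) (r : seq I) (Q : pred I) (F : I -> nat) :
  natE (\sum_(i <- r | Q i) F i) = (\sum_(i <- r | Q i) natE (F i))%E.
Proof. exact: (big_morph natE natED). Qed.

Lemma floor_divE_ge0 x k : (0 <= x -> 0 <= floor_divE x k)%E.
Proof. by case: x => [r| |] //=; rewrite !lee_fin; nia. Qed.

Lemma floor_divE_le x y k : (x <= y -> floor_divE x k <= floor_divE y k)%E.
Proof.
case: x y => [r| |] [s| |] //=; rewrite ?leey ?leNye //.
by rewrite !lee_fin; apply: lez_pdiv2r.
Qed.

Lemma le_floor_divE c x k : 0 < k ->
  (natE (c * k) <= x -> natE c <= floor_divE x k)%E.
Proof.
move=> k_gt0; case: x => [r| |] //=; rewrite ?leey // !lee_fin => le_r.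
by rewrite lez_divRL // -PoszM.
Qed.

(** Multiplication by [x], possibly infinite, preserves or reverses the order according to the sign
    of [x], so its extremes lie at the endpoints. The reversing case is reduced to the preserving
    one for [- x]. *)
Lemma mule_minmax_r (x c d : \bar int) (y : int) : (c <= y%:E -> y%:E <= d ->
  mine (x * c) (x * d) <= x * y%:E /\ x * y%:E <= maxe (x * c) (x * d))%E.
Proof.
move=> cy yd; have [x_ge0|x_lt0] := leP 0%E x.
  by split; rewrite ?ge_min ?le_max; apply/orP; [left|right]; apply: lee_wpmul2l.
have Nx_ge0 : (0 <= - x)%E by rewrite oppe_ge0 ltW.
have le_mul (a b : \bar int) : (a <= b -> x * b <= x * a)%E.
  by move=> /(lee_wpmul2l Nx_ge0); rewrite !mulNe leeN2.
by split; rewrite ?ge_min ?le_max; apply/orP; [right|left]; apply: le_mul.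
Qed.

(** The one-variable case is used twice: first the factor between [a] and [b] varies with [y] fixed,
    then, at each of these endpoints, the factor between [c] and [d]. *)
Lemma mule_minmax (a b c d : \bar int) (x y : int) :
  (a <= x%:E -> x%:E <= b -> c <= y%:E -> y%:E <= d ->
   mine (mine (a * c) (a * d)) (mine (b * c) (b * d)) <= (x * y)%:E /\
   (x * y)%:E <= maxe (maxe (a * c) (a * d)) (maxe (b * c) (b * d)))%E.
Proof.
move=> ax xb cy yd.
have [lo hi] := mule_minmax_r y%:E ax xb.
have [lo1 hi1] := mule_minmax_r a cy yd.
have [lo2 hi2] := mule_minmax_r b cy yd.
rewrite EFinM [(x%:E * _)%E]muleC; split.
  by apply: le_trans lo; rewrite ![(y%:E * _)%E]muleC le_min2.
by apply: le_trans hi _; rewrite ![(y%:E * _)%E]muleC le_max2.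
Qed.

(** Lexicographic descent: either the number of infinite entries drops, or the infinite entries stay
    in place and the sum of the finite ones drops. *)
Lemma decreasing_wf (I : finType) :
  well_founded (fun g f : {ffun I -> \bar int} =>
    [/\ forall i, (0 <= g i)%E, forall i, (g i <= f i)%E & g != f]).
Proof.
pose infs (f : {ffun I -> \bar int}) := [set i | f i == +oo%E].
pose weight (f : {ffun I -> \bar int}) := \sum_i `|fine (f i)|%N.
move=> f; move En: #|infs f| => n; move Em: (weight f) => m.
elim/ltn_ind: n m f En Em => n IHn; elim/ltn_ind => m IHm f En Em.
constructor=> g [g_ge0 le_gf ne_gf].
have sub : infs g \subset infs f.
  apply/subsetP => i; rewrite !inE => /eqP gi.
  by have := le_gf i; rewrite gi leye_eq.
have [lt_n|le_n] := ltnP #|infs g| n; first exact: IHn lt_n _ _ erefl erefl.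
have eq_infs : infs g = infs f by apply/eqP; rewrite eqEcard sub En.
(* [fine] sends [+oo] to 0, which is harmless since [f] and [g] are infinite at the same indices.
   The equality condition carried by [leqif] survives summation, so equal weights would force
   [g = f]. *)
have le_fine i : `|fine (g i)| <= `|fine (f i)| ?= iff (g i == f i).
  have /setP/(_ i) := eq_infs; rewrite !inE.
  have := g_ge0 i; have := le_gf i.
  case: (g i) (f i) => [r| |] [s| |] //=; rewrite !lee_fin => le_rs r_ge0 _.
  by rewrite eqe; apply/leqifP; case: eqP => [->|] //; lia.
apply: (IHm (weight g)) => //; last by rewrite eq_infs.
rewrite -Em ltn_neqAle; have [-> ->] := leqif_sum (fun i (_ : predT i) => le_fine i).
rewrite andbT; apply: contra ne_gf => /forall_inP eq_gf.
by apply/eqP/ffunP => i; apply/eqP/eq_gf.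
Qed.

(** * Enabledness and token balance along runs *)

Section Net.
Variable N : petri_game.
Local Notation P := (place N).
Local Notation T := (transition N).
Local Notation nrun := (@run (net_arena N)).
Implicit Types (p : P) (t a : T) (A X Y Z B : {set T}) (M : marking N) (w : seq T).
Implicit Types (u v : bounds N) (f g : formula N) (e : expr N) (c : config N).

Lemma enabledP M t :
  reflect (forall p, Win p t <= M p /\ below_inhib (M p) (inhib p t))
          (enabled M t).
Proof.
apply: (iffP forallP) => h p; first by apply/andP/h.
by apply/andP/h.
Qed.

Lemma disabledP M t :
  reflect (exists p, (M p < Win p t) || ~~ below_inhib (M p) (inhib p t))
          (t \notin en M).
Proof.
rewrite inE negb_forall; apply: (iffP existsP) => -[p h]; exists p.
  by move: h; rewrite negb_and -ltnNge.
by rewrite negb_and -ltnNge.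
Qed.

Lemma canE M t : @can (net_arena N) M t <-> enabled M t.
Proof. by split=> [[M' []]|en_t] //; exists (fire M t). Qed.

Lemma can1E M t : @can1 (net_arena N) M t <-> t \in en1 M.
Proof.
rewrite /can1 /= !inE; split=> [[-> /canE ->] //|/andP[en_t ->]].
by split=> //; apply/canE.
Qed.

Lemma can2E M t : @can2 (net_arena N) M t <-> t \in en2 M.
Proof.
rewrite /can2 /player2 /= !inE; split=> [[-> /canE ->] //|/andP[en_t ->]].
by split=> //; apply/canE.
Qed.

Lemma ex_can1E M : (exists a, @can1 (net_arena N) M a) <-> en1 M != set0.
Proof.
by split=> [[a /can1E ?]|/set0Pn[a ?]]; [apply/set0Pn|]; exists a => //; apply/can1E.
Qed.

Lemma ex_can2E M : (exists a, @can2 (net_arena N) M a) <-> en2 M != set0.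
Proof.
by split=> [[a /can2E ?]|/set0Pn[a ?]]; [apply/set0Pn|]; exists a => //; apply/can2E.
Qed.

Lemma fireE M t p : enabled M t -> fire M t p + Win p t = M p + Wout t p.
Proof. by move=> /enabledP/(_ p)[le_Win _]; rewrite ffunE; lia. Qed.

Lemma in_pplus p t : (t \in pplus p) = (Win p t < Wout t p).
Proof. by rewrite inE; lia. Qed.

Lemma in_pminus p t : (t \in pminus p) = (Wout t p < Win p t).
Proof. by rewrite !inE; lia. Qed.

Lemma in_ominus p t : (p \in ominus t) = (Wout t p < Win p t).
Proof. by rewrite !inE; lia. Qed.

Lemma in_oplus p t : (p \in oplus t) = (Win p t < Wout t p).
Proof. by rewrite inE; lia. Qed.

(** Subtraction is truncated, so a transition contributes to at most one of the two sums: its net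
    loss on the left or its net gain on the right. *)
Lemma run_flow M w M' p : nrun M w M' ->
  M' p + \sum_(t <- w) (Win p t - Wout t p) =
  M p + \sum_(t <- w) (Wout t p - Win p t).
Proof.
elim: w M => [|t w IHw] M /=; first by move=> <-; rewrite !big_nil.
by case=> _ [en_t ->] /IHw; have := fireE p en_t; rewrite !big_cons; lia.
Qed.

Lemma run_noplus M w M' p : {subset w <= ~: pplus p} -> nrun M w M' ->
  M' p <= M p.
Proof.
move=> wp /(run_flow p); rewrite [X in _ = _ + X]big_seq [X in _ = _ + X]big1 => [|t /wp].
  by lia.
by rewrite in_setC in_pplus; lia.
Qed.

Lemma run_nominus M w M' p : {subset w <= ~: pminus p} -> nrun M w M' ->
  M p <= M' p.
Proof.
move=> wp /(run_flow p); rewrite [X in _ + X = _]big_seq [X in _ + X = _]big1 => [|t /wp].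
  by lia.
by rewrite in_setC in_pminus; lia.
Qed.

Lemma run_rcons M w a M' : nrun M (rcons w a) M' <->
  exists2 M1, nrun M w M1 & enabled M1 a /\ M' = fire M1 a.
Proof.
elim: w M => [|b w IHw] M /=.
  split=> [[M1 h <-]|[M1 <- h]]; first by exists M.
  by exists M'.
split=> [[M1 h /IHw[M2 r e]]|[M2 [M1 h r] e]]; first by exists M2 => //; exists M1.
by exists M1 => //; apply/IHw; exists M2.
Qed.

(** * Saturated sets *)

(** These are the transitions that firing [t] can disable: they need tokens where [t] has a net
    loss, or are inhibited where it has a net gain. *)
Definition influenced t : {set T} :=
  (\bigcup_(p in ominus t) ppost p) :|: (\bigcup_(p in oplus t) pinh p).

(** The disjuncts mirror the three branches of the saturation loop. The parameter [Z] can stand for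
    a final set or for an intermediate one that includes pending transitions. *)
Definition closed_at M Z t : Prop :=
  [\/ exists2 p, M p < Win p t & pplus p \subset Z,
      exists2 p, ~~ below_inhib (M p) (inhib p t) & pminus p \subset Z
    | t \in en M /\ influenced t \subset Z].

Definition saturated M X : Prop := forall t, t \in X -> closed_at M X t.

Lemma closed_atS M Z Z' t : Z \subset Z' -> closed_at M Z t -> closed_at M Z' t.
Proof.
move=> sZ [[p h s]|[p h s]|[h s]]; have s' := subset_trans s sZ.
- by constructor 1; exists p.
- by constructor 2; exists p.
- by constructor 3.
Qed.

Lemma subset_setC w X Y : {subset w <= ~: X} -> Y \subset X -> {subset w <= ~: Y}.
Proof.
by move=> wX sYX t /wX; rewrite !in_setC; apply: contra; apply: (subsetP sYX).
Qed.

Lemma below_inhib_leq m n i : m <= n -> below_inhib n i -> below_inhib m i.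
Proof. by case: i => //= k; lia. Qed.

(** If [a] were blocked at [M], then [X] would contain every transition able to repair the blocking
    place, and the run outside [X] could not unblock it. *)
Lemma saturated_enabled M X w M' a : saturated M X -> a \in X ->
  {subset w <= ~: X} -> nrun M w M' -> enabled M' a ->
  a \in en M /\ influenced a \subset X.
Proof.
move=> satX aX wX r /enabledP en_a; have [[p h s]|[p h s]|//] := satX _ aX.
  have := run_noplus (subset_setC wX s) r; have [] := en_a p; lia.
have le_M := run_nominus (subset_setC wX s) r.
by have [_ /(below_inhib_leq le_M)] := en_a p; rewrite (negPf h).
Qed.

(* The marking of the commuted run is shifted by the constant effect of [a]. *)
Lemma saturated_commute M X w a M' : saturated M X -> {subset w <= ~: X} ->
  a \in X -> nrun M (rcons w a) M' -> nrun M (a :: w) M'.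
Proof.
move=> satX wX aX /run_rcons[M1 r [en_a ->]].
have [] := saturated_enabled satX aX wX r en_a; rewrite inE => en_aM infl.
exists (fire M a) => //.
have shift p := fireE p en_aM; have shift1 p := fireE p en_a.
(* After generalisation the induction carries only the shift equations between the two runs, which
   firing a common transition preserves. *)
move: (fire M a) (fire M1 a) shift shift1 => K K1 shift shift1.
have {}wX : {in w, forall t, t \notin influenced a}.
  by move=> t /(subset_setC wX infl); rewrite in_setC.
elim: w wX M K shift r {satX en_aM} => [|t w IHw] wX M K shift /=.
  by move=> eM; apply/ffunP => p; have := shift p; have := shift1 p; rewrite eM; lia.
case=> _ [en_t ->] r.
(* Since [t] is not influenced by [a], the shift takes no tokens from a place in the preset of [t]
   and adds none to a place inhibiting it. *)
have en_tK : enabled K t.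
  apply/enabledP => p; have [le_Win bel] := enabledP _ _ en_t p.
  have := wX t (mem_head _ _); rewrite in_setU negb_or => /andP[/bigcupP no1 /bigcupP no2].
  split.
    have [->//|Win_gt0] := posnP (Win p t).
    have: p \notin ominus a by apply/negP => pa; apply: no1; exists p => //; rewrite inE.
    by rewrite in_ominus; have := shift p; lia.
  move: bel; case E: (inhib p t) => [k|] //=.
  have: p \notin oplus a by apply/negP => pa; apply: no2; exists p => //; rewrite inE E.
  by rewrite in_oplus; have := shift p; lia.
exists (fire K t) => //; apply: IHw r => [b bw|p].
  by apply: wX; rewrite inE bw orbT.
by have := fireE p en_t; have := fireE p en_tK; have := shift p; lia.
Qed.

Lemma disabling_enabled M w M' t : enabled M t ->
  {subset w <= ~: disabling t} -> nrun M w M' -> enabled M' t.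
Proof.
move=> /enabledP en_t wd r; apply/enabledP => p; have [le_Win bel] := en_t p.
split.
  have [->//|Win_gt0] := posnP (Win p t); apply: leq_trans le_Win _.
  apply: run_nominus r; apply: subset_setC wd _; rewrite /disabling.
  by apply: subsetU; rewrite (bigcup_sup p) // inE.
case E: (inhib p t) => [k|//]; rewrite -E; apply: below_inhib_leq bel.
apply: run_noplus r; apply: subset_setC wd _; rewrite /disabling.
by apply: subsetU; rewrite (bigcup_sup p) ?orbT // inE E.
Qed.

(** * Soundness of the bounds *)

(** Passage from a word to its Parikh vector, the form in which bounds on the number of firings of
    each transition apply. *)
Lemma sum_count w A (F : T -> nat) :
  {in w, forall t, t \notin A -> F t = 0} ->
  \sum_(t <- w) F t = \sum_(t in A) count_mem t w * F t.
Proof.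
elim: w => [|a w IHw] wA; first by rewrite big_nil big1.
rewrite big_cons IHw => [|t tw]; last by apply: wA; rewrite inE tw orbT.
under [RHS]eq_bigr do rewrite /= mulnDl.
rewrite big_split /=; congr addn.
have [aA|aA] := boolP (a \in A).
  rewrite (bigD1 a) //= eqxx mul1n big1 ?addn0 // => t /andP[_].
  by rewrite eq_sym => /negPf->.
rewrite (wA a) ?mem_head // big1 // => t tA.
by case: eqP => // eat; rewrite eat tA in aA.
Qed.

(* [u.1 p] bounds the tokens that are ever available in [p], i.e. the initial
   ones plus the total inflow, and not only the number present at any moment:
   this is what makes the division by the consumption of [t] sound. *)
Definition valid_bounds M u : Prop :=
  forall w M', {subset w <= T2 N} -> nrun M w M' ->
  (forall t, t \in T2 N -> (natE (count_mem t w) <= u.2 t)%E) /\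
  (forall p, (natE (M p + \sum_(t <- w) (Wout t p - Win p t)) <= u.1 p)%E).

Lemma valid_init M : valid_bounds M (ub_init M).
Proof.
move=> w M' wT2 r; split=> [t _|p]; rewrite /= ffunE ?leey //.
case: ifP => [/forall_inP noinc|_]; last by rewrite leey.
rewrite big_seq big1 ?addn0 // => t /wT2/noinc; lia.
Qed.

(** The old place bounds limit the firing counts, because a run cannot consume more than the initial
    tokens plus the inflow; the new counts then limit the inflow. *)
Lemma valid_step M u : valid_bounds M u -> valid_bounds M (ub_step M u).
Proof.
move=> val w M' wT2 r; have [leT leP] := val w M' wT2 r.
have leT' t : t \in T2 N -> (natE (count_mem t w) <= ub_trans u.1 t)%E.
  move=> tT2; rewrite ffunE tT2; apply: le_bigmin => [|p]; first by rewrite leey.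
  rewrite in_ominus => lt_t; apply: le_floor_divE; first by lia.
  (* By the balance equation, initial tokens plus inflow equal final tokens plus outflow, and the
     consumption of [t] is one summand of the outflow. *)
  apply: le_trans (leP p); rewrite lee_fin lez_nat -(run_flow p r).
  rewrite (@sum_count w [set: T]) => [|? _]; last by rewrite inE.
  by rewrite (bigD1 t) ?inE //=; lia.
split=> // p; rewrite /= ffunE natED leeD2l //.
rewrite (@sum_count w (T2 N :&: pplus p)) => [|t /wT2 tT2]; last first.
  by rewrite in_setI tT2 in_pplus; lia.
rewrite natE_sum; apply: lee_sum => t /setIP[tT2 _].
by rewrite natEM lee_wpmul2r ?natE_ge0 ?leT'.
Qed.

Lemma valid_ub M u w M' p : valid_bounds M u ->
  {subset w <= T2 N} -> nrun M w M' -> (natE (M' p) <= u.1 p)%E.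
Proof.
move=> val wT2 r; have [_ /(_ p)] := val w M' wT2 r; apply: le_trans.
by rewrite lee_fin lez_nat -(run_flow p r); lia.
Qed.

(** The firing counts bound the total outflow, and the final marking is at least the initial one
    minus this outflow. *)
Lemma valid_lb M u w M' p : valid_bounds M u ->
  {subset w <= T2 N} -> nrun M w M' -> (lb_place M u p <= natE (M' p))%E.
Proof.
move=> val wT2 r; have [leT _] := val w M' wT2 r; rewrite ffunE.
set S := (\sum_(t in _ | _) _)%E.
have le_S : (natE (\sum_(t <- w) (Win p t - Wout t p)) <= S)%E.
  rewrite (@sum_count w (T2 N :&: pminus p)) => [|t /wT2 tT2]; last first.
    by rewrite in_setI tT2 in_pminus; lia.
  rewrite natE_sum /S; under eq_bigl do rewrite in_setI in_pminus.
  apply: lee_sum => t /andP[tT2 _].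
  by rewrite natEM lee_wpmul2r ?natE_ge0 ?leT.
apply: le_trans (leeB (lexx _) le_S) _.
by rewrite -EFinB lee_fin; have := run_flow p r; lia.
Qed.

Section Sound.
Variables (M : marking N) (lb ub : {ffun P -> \bar int}).
Hypothesis lbP : forall p, (lb p <= natE (M p))%E.
Hypothesis ubP : forall p, (natE (M p) <= ub p)%E.

Lemma eval_bounds e :
  (lbE lb ub e <= (eval M e)%:E)%E /\ ((eval M e)%:E <= ubE lb ub e)%E.
Proof.
elim: e => [c|p|e1 [l1 u1] e2 [l2 u2]|e1 [l1 u1] e2 [l2 u2]|e1 [l1 u1] e2 [l2 u2]] /=.
- by rewrite lexx.
- by split; [exact: lbP|exact: ubP].
- by rewrite EFinD !leeD.
- by rewrite EFinB !leeB.
- exact: mule_minmax.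
Qed.

Lemma bsat_trans_sound t : enabled M t -> bsat_trans lb ub t.
Proof.
move=> /enabledP en_t; apply/andP; split; apply/forall_inP => p.
  by move=> _; apply: le_trans (ubP p); rewrite lee_fin lez_nat; case: (en_t p).
rewrite inE /inhibE => inh_p; apply: le_lt_trans (lbP p) _.
by have [_] := en_t p; case: (inhib p t) inh_p => //= k _; rewrite lte_fin ltz_nat.
Qed.

Lemma bsat_ntrans_sound t : ~~ enabled M t -> bsat_ntrans lb ub t.
Proof.
rewrite negb_forall => /existsP[p]; rewrite negb_and -ltnNge => /orP[lt_p|inh_p].
  apply/orP; left; apply/exists_inP; exists p; first by rewrite inE; lia.
  by apply: le_lt_trans (lbP p) _; rewrite lte_fin ltz_nat.
apply/orP; right; apply/exists_inP; exists p.
  by rewrite inE; case: (inhib p t) inh_p.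
apply: le_trans (ubP p); rewrite /inhibE; case: (inhib p t) inh_p => //= k.
by rewrite -leqNgt lee_fin lez_nat.
Qed.

Lemma bsat_cmp_sound o e1 e2 :
  eval_cmp o (eval M e1) (eval M e2) -> bsat_cmp lb ub o e1 e2.
Proof.
have [l1 u1] := eval_bounds e1; have [l2 u2] := eval_bounds e2.
case: o => /=.
- by move=> h; apply: le_lt_trans l1 _; apply: lt_le_trans u2; rewrite lte_fin.
- by move=> h; apply: le_trans l1 _; apply: le_trans u2; rewrite lee_fin.
- move=> /eqP E; rewrite ge_max !le_min.
  by rewrite (le_trans l1 u1) (le_trans l2 u2) (le_trans l1) ?E // (le_trans l2) // -E.
(* If all four bounds coincide, both intervals collapse to the same point and the two values
   agree. *)
- apply: contra => /and3P[/eqP E1 /eqP E2 /eqP E3].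
  move: l1 u1 l2 u2; rewrite -E3 -E2 -E1 => l1 u1 l2 u2.
  by rewrite eq_le -!lee_fin (le_trans u1 l2) (le_trans u2 l1).
- by move=> h; apply: le_lt_trans l2 _; apply: lt_le_trans u1; rewrite lte_fin.
- by move=> h; apply: le_trans l2 _; apply: le_trans u1; rewrite lee_fin.
Qed.

Lemma eval_cmpC o (x y : int) : eval_cmp (cmpC o) x y = ~~ eval_cmp o x y.
Proof. by case: o => /=; rewrite ?negbK ?leNgt ?ltNge ?negbK. Qed.

(** Both polarities are proved together, since [FNot] exchanges them. *)
Lemma bsat_sound f :
  (sat M f -> bsat lb ub (nnf false f)) /\ (~~ sat M f -> bsat lb ub (nnf true f)).
Proof.
elim: f => [||t|o e1 e2||f1 [p1 n1] f2 [p2 n2]|f1 [p1 n1] f2 [p2 n2]|f1 [p1 n1]] //=.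
- by rewrite inE; split; [exact: bsat_trans_sound|exact: bsat_ntrans_sound].
- split; first exact: bsat_cmp_sound.
  by rewrite -eval_cmpC; exact: bsat_cmp_sound.
- split=> [/eqP dead|/set0Pn[t]].
    apply/forallP => t; apply: bsat_ntrans_sound.
    by apply/negP => en_t; have := in_set0 t; rewrite -dead inE en_t.
  by rewrite inE => /bsat_trans_sound en_t; apply/existsP; exists t.
- split=> [/andP[/p1-> /p2->] //|]; rewrite negb_and => /orP[/n1->|/n2->] //.
  by rewrite orbT.
- split=> [/orP[/p1->|/p2->]|] //; rewrite ?orbT //.
  by rewrite negb_or => /andP[/n1-> /n2->].
- by split=> //; rewrite negbK.
Qed.

End Sound.
(** * Termination of the bound computation *)

Lemma ub_trans_ge0 (h : {ffun P -> \bar int}) t :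
  (forall p, (0 <= h p)%E) -> (0 <= ub_trans h t)%E.
Proof.
move=> h_ge0; rewrite ffunE; case: ifP => // _; apply: le_bigmin => // p _.
exact: floor_divE_ge0.
Qed.

Lemma ub_place_ge0 M (h : {ffun T -> \bar int}) p :
  (forall t, (0 <= h t)%E) -> (0 <= ub_place M h p)%E.
Proof.
move=> h_ge0; rewrite ffunE adde_ge0 ?natE_ge0 //; apply: sume_ge0 => t _.
by rewrite mule_ge0 ?natE_ge0.
Qed.

Lemma ub_trans_le (h k : {ffun P -> \bar int}) t :
  (forall p, (h p <= k p)%E) -> (ub_trans h t <= ub_trans k t)%E.
Proof.
move=> le_hk; rewrite !ffunE; case: ifP => // _; apply: le_bigmin2 => p _.
exact: floor_divE_le.
Qed.

Lemma ub_place_le M (h k : {ffun T -> \bar int}) p :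
  (forall t, (h t <= k t)%E) -> (ub_place M h p <= ub_place M k p)%E.
Proof.
move=> le_hk; rewrite !ffunE leeD2l //; apply: lee_sum => t _.
by rewrite lee_wpmul2r ?natE_ge0.
Qed.

Lemma ub_step_ge0 M u p : (forall p, (0 <= u.1 p)%E) -> (0 <= (ub_step M u).1 p)%E.
Proof. by move=> u_ge0; apply: ub_place_ge0 => t; apply: ub_trans_ge0. Qed.

(** Monotonicity passes the descent of the first iteration on to all later ones. *)
Lemma ub_step_le M u v p :
  (forall p, (u.1 p <= v.1 p)%E) -> ((ub_step M u).1 p <= (ub_step M v).1 p)%E.
Proof. by move=> le_uv; apply: ub_place_le => t; apply: ub_trans_le. Qed.

(** A place with a finite initial bound has no net producer among the transitions of player 2, so
    its inflow sum is empty; every other place starts at [+oo]. *)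
Lemma ub_step_init M p : ((ub_step M (ub_init M)).1 p <= (ub_init M).1 p)%E.
Proof.
rewrite /= [X in (_ <= X)%E]ffunE; case: ifP => [/forall_inP noinc|_]; last by rewrite leey.
rewrite ffunE big1 ?adde0 // => t /setIP[/noinc]; rewrite in_pplus; lia.
Qed.

(** * Termination of saturation and of whole executions *)

Definition next_step M f : config N -> config N -> Prop :=
  fun c' c => stub_step M f c c'.

Lemma returned_acc M f A X : Acc (next_step M f) (Returned A X).
Proof. by constructor=> c st; inversion st. Qed.

(** Inversion that treats the three processing rules uniformly: each adds some [B] that makes [t]
    closed. It serves both termination and the invariant. *)
Lemma saturating_step M f A X Y c : stub_step M f (Saturating A X Y) c ->
  (exists t B, [/\ t \in Y, closed_at M B t &
     c = Saturating A (t |: X) ((Y :|: (B :\: X)) :\ t)]) \/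
  (Y = set0 /\ exists2 X', c = Returned A X' &
     X' = setT \/ X' = X /\ all_safe M (X :&: en1 M)).
Proof.
move E: (Saturating A X Y) => c0 st; case: c0 c / st E => //.
- move=> A' X' Y' t p tY _ _ lt_p [-> -> ->]; left; exists t, (pplus p).
  by split=> //; constructor 1; exists p.
- move=> A' X' Y' t p tY _ _ _ inh_p [-> -> ->]; left; exists t, (pminus p).
  by split=> //; constructor 2; exists p.
- move=> A' X' Y' t tY en_t [-> -> ->]; left; exists t, (influenced t).
  by split=> //; constructor 3.
- by move=> A' X' _ [-> -> ->]; right; split=> //; exists setT => //; left.
- by move=> A' X' safe [-> -> ->]; right; split=> //; exists X' => //; right.
Qed.

(** The complement of [X] shrinks at each step. Disjointness guarantees that the processed
    transition is new, and persists because only [B :\: X] is added and [t] leaves [Y]. *)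
Lemma saturating_acc M f A X Y :
  [disjoint X & Y] -> Acc (next_step M f) (Saturating A X Y).
Proof.
move En: #|~: X| => n; elim/ltn_ind: n X Y En => n IHn X Y En dis.
constructor=> c /saturating_step[[t [B [tY _ ->]]]|[_ [X' -> _]]]; last first.
  exact: returned_acc.
have tX : t \notin X by rewrite (disjointFl dis tY).
apply: IHn erefl _.
  rewrite -En; apply: proper_card; rewrite properC.
  by apply/properP; split; [exact: subsetUr|exists t; rewrite ?setU11].
rewrite -setI_eq0; apply/eqP/setP => x; rewrite !inE.
case: eqP => //= _; case xX: (x \in X) => //=.
by rewrite (disjointFr dis xX).
Qed.

Lemma reaching_step M f A u c : stub_step M f (Reaching A u) c ->
  (ub_step M u != u /\ c = Reaching A (ub_step M u)) \/
  (ub_step M u = u /\ (c = Returned A setT \/ exists Y, c = Saturating A set0 Y)).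
Proof.
move=> st; inversion_clear st as [| | | | |? ? ne|? ? eq|? ? t eq| | | | |].
- by left.
- by right; split; [exact: eq|left].
- by right; split; [exact: eq|right; eexists].
Qed.

Lemma reaching_acc M f A u :
  (forall p, (0 <= u.1 p)%E) -> (forall p, ((ub_step M u).1 p <= u.1 p)%E) ->
  Acc (next_step M f) (Reaching A u).
Proof.
have stop v c : ub_step M v = v -> stub_step M f (Reaching A v) c ->
    Acc (next_step M f) c.
  move=> eq /reaching_step[[ne _]|[_ [->|[Y ->]]]].
  - by rewrite eq eqxx in ne.
  - exact: returned_acc.
  - by apply: saturating_acc; rewrite -setI_eq0 set0I.
move En: u.1 => h; elim/(well_founded_ind (@decreasing_wf P)): h u En.
move=> h IH u En; rewrite -En in IH *; move=> {h En} u_ge0 le_u; constructor=> c st.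
have [[_ ->]|[eq _]] := reaching_step st; last exact: stop eq st.
(* The well-founded order sees only places. As [ub_step] reads only [u.1], an unchanged place
   component makes [ub_step M u] a fixed point, even if the transition component has just
   changed. *)
have [eq1|ne1] := eqVneq (ub_step M u).1 u.1.
  constructor=> c'; apply: stop.
  by rewrite {1}/ub_step eq1.
apply: (IH _ _ _ erefl) => [|p|p].
- by split=> // p; apply: ub_step_ge0.
- exact: ub_step_ge0.
- exact: ub_step_le.
Qed.

Lemma init_acc M f : Acc (next_step M f) (@Init N).
Proof.
constructor=> c st; inversion st as [A _| | | | | | | | | | | |]; subst.
constructor=> c' st'; inversion st'; subst.
- exact: returned_acc.
- exact: returned_acc.
- apply: reaching_acc => p; last exact: ub_step_init.
  by rewrite ffunE; case: ifP => _; rewrite ?natE_ge0 ?leey.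
- by apply: saturating_acc; rewrite -setI_eq0 set0I.
Qed.

(** * Existence of interesting sets *)

(** Excluded middle is applied to [all_safe], a proposition that quantifies over all runs. *)
Lemma select_and_ex M f1 f2 A1 A2 : ~~ (sat M f1 && sat M f2) ->
  exists A, select_and M f1 f2 A1 A2 A.
Proof.
move=> nsat; have [s2|s2] := boolP (sat M f2); first by exists A1; apply: and_sat2.
have [s1|s1] := boolP (sat M f1); first by exists A2; apply: and_sat1.
have [safe1|safe1] := classic (all_safe M A1); first by exists A1; apply: and_safe1.
have [safe2|safe2] := classic (all_safe M A2); first by exists A2; apply: and_safe2.
by exists A1; apply: and_any1.
Qed.

(** The negation is included in the induction because the De Morgan rules recurse on negated
    subformulas. *)
Lemma interesting_ex M f :
  (exists A, interesting M f A) /\ (exists A, interesting M (FNot f) A).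
Proof.
have unsat g : (~~ sat M g -> exists A, interesting M g A) ->
    exists A, interesting M g A.
  by have [s _|_] := boolP (sat M g); [exists set0; apply: int_sat | apply].
elim: f => [||t|o e1 e2||f1 [[A1 p1] [B1 n1]] f2 [[A2 p2] [B2 n2]]
           |f1 [[A1 p1] [B1 n1]] f2 [[A2 p2] [B2 n2]]|f1 [[A1 p1] [B1 n1]]];
  split; apply: unsat => // nsat.
- by exists set0; apply: int_ntrue.
- by exists set0; apply: int_false.
- have /disabledP[p /orP[lt_p|inh_p]] := nsat.
    by exists (pplus p); apply: (int_trans_pre _ lt_p); rewrite inE; lia.
  exists (pminus p); apply: (int_trans_inh (p := p)) => //.
  by rewrite inE; case: (inhib p t) inh_p.
- by exists (disabling t); apply: int_ntrans.
- by exists (interesting_cmp M o e1 e2); apply: int_cmp.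
- by exists (interesting_cmp M (cmpC o) e1 e2); apply: int_ncmp.
- have /set0Pn[t en_t] := nsat.
  by exists (t |: disabling t); apply: int_deadlock.
- by exists set0; apply: int_ndeadlock.
- by have [A sel] := select_and_ex A1 A2 nsat; exists A; apply: int_and sel.
- by exists (B1 :|: B2); apply: int_nand.
- by exists (A1 :|: A2); apply: int_or.
- have [|A sel] := @select_and_ex M (FNot f1) (FNot f2) B1 B2.
    by rewrite /= -negb_or.
  by exists A; apply: int_nor sel.
- by exists B1.
- by exists A1; apply: int_nnot.
Qed.

(** * Invariants of the algorithm *)

Definition player1_seed M Z : Prop :=
  [/\ en1 M != set0, en2 M = set0 & T2 N \subset Z].

(** The last clause records the meaning of a failed [reach_check], since the configuration forgets
    the bounds when saturation starts. *)
Definition player2_seed M f Z : Prop :=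
  [/\ en1 M = set0, T1 N \subset Z,
      exists2 t, t \in en2 M & t |: disabling t \subset Z
    & forall w M', {subset w <= T2 N} -> nrun M w M' -> ~~ sat M' f].

Definition seeded M f A Z : Prop :=
  A \subset Z /\ (player1_seed M Z \/ player2_seed M f Z).

(** During saturation, closure is relative to [X :|: Y]; once [Y] is empty this says that [X] is
    saturated. The alternative [X = setT] covers the trivial returns. *)
Definition stub_inv M f c : Prop :=
  match c with
  | Init | Started _ => True
  | Reaching _ u => [/\ en1 M = set0, en2 M != set0 & valid_bounds M u]
  | Saturating A X Y =>
      seeded M f A (X :|: Y) /\ forall t, t \in X -> closed_at M (X :|: Y) t
  | Returned A X => X = setT \/
      [/\ seeded M f A X, saturated M X & all_safe M (X :&: en1 M)]
  end.

Lemma seededS M f A Z Z' : Z \subset Z' -> seeded M f A Z -> seeded M f A Z'.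
Proof.
move=> sZ [AZ seed]; split; first exact: subset_trans sZ.
case: seed => [[? ? s]|[? s [t ? s'] ?]]; [left|right].
  by split=> //; apply: subset_trans sZ.
split=> //; first exact: subset_trans sZ.
by exists t => //; apply: subset_trans sZ.
Qed.

(** The bounds computed from [M] enclose every marking that player 2 can reach, so soundness of
    [bsat] is applied at [M']. *)
Lemma reach_check_sound M f u w M' : valid_bounds M u -> ~~ reach_check M f u ->
  {subset w <= T2 N} -> nrun M w M' -> ~~ sat M' f.
Proof.
move=> val nreach wT2 r; apply: contra nreach => s.
apply: (proj1 (@bsat_sound M' _ _ _ _ f)) s => p.
  exact: valid_lb r.
exact: valid_ub r.
Qed.

Lemma stub_step_inv M f c c' : stub_step M f c c' -> stub_inv M f c -> stub_inv M f c'.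
Proof.
move=> st; have sat_inv A X Y : c = Saturating A X Y -> stub_inv M f c -> stub_inv M f c'.
  move=> Ec; rewrite Ec in st *; case=> seed clos.
  have [[t [B [tY cl ->]]]|[Y0 [X' -> []]]] := saturating_step st.
  (* No element is lost in the update: [t] moves from [Y] to [X], and what is subtracted from [B]
     already lies in [X]. *)
  - have sub Z : Z \subset X :|: (Y :|: B) ->
        Z \subset (t |: X) :|: ((Y :|: (B :\: X)) :\ t).
      move=> /subsetP sZ; apply/subsetP => x /sZ; rewrite !inE.
      by case: eqP => //= _; case: (x \in X) => //=.
    have sub1 := sub _ (setUS X (subsetUl Y B)).
    split=> [|x /setU1P[->|/clos]]; first exact: seededS seed.
      by apply: closed_atS cl; apply: sub; rewrite setUA subsetUr.
    exact: closed_atS.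
  - by move=> ->; left.
  - case=> -> safe; right; move: seed clos; rewrite Y0 setU0 => seed clos.
    by split.
case: c c' / st sat_inv => //=.
- by left.
- by left.
- by move=> A e1 e2 _ _; split=> //; apply: valid_init.
- move=> A e1 e2 _ _; rewrite set0U; split=> [|t]; last by rewrite inE.
  by split; [exact: subsetUr|left; split=> //; exact: subsetUl].
- by move=> A u _ _ [e1 e2 val]; split=> //; apply: valid_step.
- by left.
- move=> A u t _ nreach en_t _ [e1 e2 val]; rewrite set0U.
  split=> [|x]; last by rewrite inE.
  split; [exact: subsetUr|right; split=> //].
  + by rewrite -setUA subsetUl.
  + by exists t => //; rewrite setUAC subsetUr.
  + by move=> w M'; apply: reach_check_sound nreach.
- by move=> A X Y t p _ _ _ _ /(_ _ _ _ erefl).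
- by move=> A X Y t p _ _ _ _ _ /(_ _ _ _ erefl).
- by move=> A X Y t _ _ /(_ _ _ _ erefl).
- by move=> A X _ _; left.
- by move=> A X _ /(_ _ _ _ erefl).
Qed.

Lemma stub_steps_inv M f c c' :
  stub_steps M f c c' -> stub_inv M f c -> stub_inv M f c'.
Proof. by elim=> {c c'} [c c' /stub_step_inv //|//|c1 c2 c3 _ h1 _ h2 /h1/h2]. Qed.

Lemma en_split M : en M = en1 M :|: en2 M.
Proof. by rewrite /en1 /en2 -setIUr setUCr setIT. Qed.

(** The invariant supplies the player 2 transition to pick after a failed check. In the loop, a
    disabled transition without a deficient input place must have a violated inhibitor. *)
Lemma stub_progress M f c : stub_inv M f c ->
  (exists A X, c = Returned A X) \/ (exists c', stub_step M f c c').
Proof.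
case: c => [|A|A u|A X Y|A X] /= inv; [right|right|right|right|left].
- by have [[A int] _] := interesting_ex M f; exists (Started A); apply: stub_select.
- have [e1|e1] := eqVneq (en1 M) set0; have [e2|e2] := eqVneq (en2 M) set0.
  + by exists (Returned A setT); apply: stub_dead; rewrite en_split e1 e2 setU0.
  + by eexists; apply: stub_player2.
  + by eexists; apply: stub_player1.
  + by eexists; apply: stub_mixed.
- have [eq|ne] := eqVneq (ub_step M u) u; last by eexists; apply: reach_iter.
  have [ok|nok] := boolP (reach_check M f u); first by eexists; apply: reach_true.
  by have [_ /set0Pn[t en_t] _] := inv; eexists; apply: reach_false en_t.
- have [->|/set0Pn[t tY]] := eqVneq Y set0.
    by have [s|s] := classic (all_safe M (X :&: en1 M));
      eexists; [apply: stub_safe|apply: stub_unsafe].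
  have [en_t|nen_t] := boolP (t \in en M); first by eexists; apply: saturate_en en_t.
  have [/exists_inP[p pt lt_p]|] := boolP [exists p in pre t, M p < Win p t].
    by eexists; apply: saturate_pre lt_p.
  rewrite negb_exists_in => /forall_inP ge_p.
  have ge_pre q : q \in pre t -> Win q t <= M q by move=> /ge_p; rewrite -leqNgt.
  have /disabledP[p /orP[lt_p|inh_p]] := nen_t.
    by have := ge_pre p; rewrite inE; lia.
  eexists; apply: (saturate_inh f A X tY nen_t ge_pre _ inh_p).
  by rewrite inE; case: (inhib p t) inh_p.
- by exists A, X.
Qed.

Lemma stub_terminatesP M f : stub_terminates M f.
Proof.
split=> [|c /stub_steps_inv inv]; first exact: init_acc.
by apply: stub_progress; apply: inv.
Qed.

End Net.

Theorem theorem4p8 (N : petri_game) (phi : formula N) :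
  (forall M : marking N, stub_terminates M phi) /\
  (forall Int St : marking N -> {set transition N},
     (forall M : marking N, stub_returns M phi (Int M) (St M)) ->
     @stable_reduction (net_glts phi) Int St).
Proof.
split=> [M|Int St ret M]; first exact: stub_terminatesP.
have /stub_steps_inv/(_ I)/= [full|[[sub seed] satX safeX]] := ret M.
  (* When everything is returned, only the empty word avoids the reduction, which makes all
     conditions immediate. *)
  have nil (w : seq (transition N)) : {subset w <= ~: St M} -> w = [::].
    by case: w => // t w /(_ t (mem_head _ _)); rewrite full !inE.
  rewrite /condI /condW /condR /condG1 /condG2 /condS /condV /condD.
  split; first by move=> *; rewrite full inE.
  split; first by move=> w a M' /nil->.
  split; first by rewrite full subsetT.
  split; first by move=> no w M' /nil-> /= <-.
  split; first by move=> no w M' /nil-> /= <-.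
  split; first by right=> *; rewrite full inE.
  split; first by move=> *; rewrite full inE.
  case=> a en_a; exists a; split=> //; first by rewrite full inE.
  by move=> w M' /nil-> /= <-.
have can1_back w M' a : {subset w <= ~: St M} ->
    @run (net_glts phi) M w M' -> a \in St M ->
    @can1 (net_glts phi) M' a -> @can1 (net_glts phi) M a.
  move=> wX r aX /can1E; rewrite inE inE => /andP[en_a aT1].
  have [en_aM _] := saturated_enabled satX aX wX r en_a.
  by apply/can1E; rewrite inE en_aM.
have can2_back w M' a : {subset w <= ~: St M} ->
    @run (net_glts phi) M w M' -> a \in St M ->
    @can2 (net_glts phi) M' a -> @can2 (net_glts phi) M a.
  move=> wX r aX /can2E; rewrite inE inE => /andP[en_a aT2].
  have [en_aM _] := saturated_enabled satX aX wX r en_a.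
  by apply/can2E; rewrite inE en_aM.
(* A move of player 2 excludes the seed of player 1. This makes I vacuous here, and provides the
   failed check for V and the picked transition for D. *)
have p2 : (exists a, @can2 (net_glts phi) M a) -> player2_seed M phi (St M).
  by move=> /ex_can2E; case: seed => // -[_ ->]; rewrite eqxx.
split; first by move=> /ex_can1E e1 /p2[e1' _ _ _]; rewrite e1' eqxx in e1.
split; first by move=> w a M' wX aX; apply: saturated_commute wX aX.
split; first exact: sub.
split.
  (* Without moves of player 2 the seed contains all of [T2], so a newly enabled [a] would belong to
     [St M] and would have been enabled at [M] already. G2 is symmetric. *)
  move=> no w M' wX r [a can_a]; apply: (no); exists a.
  apply: (can2_back _ _ _ wX r _ can_a); case: can_a => aT2 _.
  case: seed => [[_ _ /subsetP]|[_ _ [t en_t _] _]]; first exact.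
  by case: no; exists t; apply/can2E.
split.
  move=> no w M' wX r [a can_a]; apply: (no); exists a.
  apply: (can1_back _ _ _ wX r _ can_a); case: can_a => aT1 _.
  case: seed => [[e1 _ _]|[_ /subsetP s _ _]]; last exact: s.
  by case: no; apply/ex_can1E.
split; first by left=> a /can1E en_a aX; apply: safeX; rewrite inE aX.
split.
  case=> w [M' [wT2 r satM']] a can_a; have [_ _ _ unreach] := p2 (ex_intro _ a can_a).
  by have := unreach w M' wT2 r; rewrite satM'.
(* The witness is the transition picked when the check failed; [St M] contains everything that can
   disable it. *)
move=> /p2[_ _ [t en_t s] _]; exists t; split; first exact/can2E.
  by apply: (subsetP s); rewrite setU11.
move=> w M' wX r; apply/can2E; move: en_t; rewrite !inE => /andP[en_t ->].
rewrite andbT; apply: disabling_enabled en_t _ r; apply: subset_setC wX _.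
by apply: subset_trans s; apply: subsetUr.
Qed.
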